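(* Let $\mathsf{C}$ be a Markov category and let $X$ be a deterministic dynamical system in $\mathsf{C}$ with monoid $M$. Suppose that (i) the underlying object $X$ of $\mathsf{C}$ has disintegrations, and (ii) the Markov colimit $X_{\mathrm{inv}}$ of the dynamical system exists. Then every invariant state $p:I\to X$ can be written as a composition $p=k\circ q$, for some object $Y$ of $\mathsf{C}$, state $q:I\to Y$ and morphism $k:Y\to X$, such that $k$ is $q$-almost surely ergodic.
   Context: A Markov category is a symmetric monoidal category $(\mathsf{C},\otimes,I)$ in which $I$ is terminal and each object $X$ carries maps $\mathrm{copy}_X:X\to X\otimes X$ and $\mathrm{del}_X:X\to I$ forming a commutative comonoid (coassociative, counital, commutative), compatible with tensor products: up to coherence isomorphisms, $\mathrm{copy}_{X\otimes Y}$ is $\mathrm{copy}_X\otimes\mathrm{copy}_Y$ followed by swapping the two middle factors. The maps $\mathrm{copy}$ are not required to be natural. A state is a morphism $p:I\to X$. A morphism $f:X\to Y$ is deterministic if $\mathrm{copy}_Y\circ f=(f\otimes f)\circ\mathrm{copy}_X$. $\mathsf{C}_{\det}$ is the subcategory of deterministic morphisms. For $q:I\to Y$ and $f,g:Y\to Z$, $f$ and $g$ are $q$-almost surely equal if $(\mathrm{id}_Y\otimes f)\circ\mathrm{copy}_Y\circ q=(\mathrm{id}_Y\otimes g)\circ\mathrm{copy}_Y\circ q$. A morphism $f:Y\to Z$ is $q$-almost surely deterministic if $\mathrm{copy}_Z\circ f$ and $(f\otimes f)\circ\mathrm{copy}_Y$ are $q$-almost surely equal. A disintegration of $p:I\to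 X$ via $f:X\to Y$ is a morphism $f^+_p:Y\to X$ with $(\mathrm{id}_X\otimes f)\circ\mathrm{copy}_X\circ p=(f^+_p\otimes\mathrm{id}_Y)\circ\mathrm{copy}_Y\circ f\circ p$. An object $X$ has disintegrations if such a morphism exists for every state $p:I\to X$ and every deterministic morphism $f:X\to Y$ (for any object $Y$). A dynamical system in $\mathsf{C}$ with monoid $M$ is an object $X$ with a monoid homomorphism $M\to\mathsf{C}(X,X)$; the endomorphism induced by $m\in M$ is again written $m:X\to X$. It is deterministic if every $m:X\to X$ is deterministic. A state $p:I\to X$ is invariant if $m\circ p=p$ for all $m\in M$. A morphism $c:X\to R$ (an observable) is invariant if $c\circ m=c$ for all $m\in M$. A Markov colimit (Markov quotient) of $X$ is an object $X_{\mathrm{inv}}$ with a deterministic invariant morphism $r:X\to X_{\mathrm{inv}}$ that is a colimit of the dynamical system both in $\mathsf{C}$ and in $\mathsf{C}_{\det}$: for every invariant $s:X\to S$ there is a unique $\tilde s:X_{\mathrm{inv}}\to S$ with $s=\tilde s\circ r$, and $\tilde s$ is deterministic if and only if $s$ is. For $q:I\to Y$ and $k:Y\to X$, $k$ is $q$-almost surely ergodic if: (a) $k$ is $q$-almost surely invariant, i.e. for every $m\in M$, $m\circ k$ and $k$ are $q$-almost surely equal; and (b) for every invariant deterministic $c:X\to R$, the composite $c\circ k$ is $q$-almost surely deterministic. *)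

(* Defs.v *)
From mathcomp Require Import all_boot.

Set Implicit Arguments.
Unset Strict Implicit.
Unset Printing Implicit Defensive.

Declare Scope cat_scope.
Delimit Scope cat_scope with cat.
Local Open Scope cat_scope.

Reserved Notation "X ~> Y" (at level 90, right associativity).
Reserved Notation "g ∘ f" (at level 40, left associativity).
Reserved Notation "X ⊗ Y" (at level 35, right associativity).
Reserved Notation "f ⊗₁ g" (at level 35, right associativity).

Record category := Category {
  ob :> Type;
  hom : ob -> ob -> Type;
  idm : forall X, hom X X;
  compm : forall X Y Z, hom Y Z -> hom X Y -> hom X Z;
  comp_idl : forall X Y (f : hom X Y), compm (idm Y) f = f;
  comp_idr : forall X Y (f : hom X Y), compm f (idm X) = f;
  comp_assoc : forall X Y Z W (h : hom Z W) (g : hom Y Z) (f : hom X Y),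
    compm h (compm g f) = compm (compm h g) f
}.
Arguments hom {c} X Y.
Arguments idm {c} X.
Arguments compm {c X Y Z} g f.

Notation "X ~> Y" := (hom X Y) : cat_scope.
Notation "g ∘ f" := (compm g f) : cat_scope.

(* Not assumed strict: the associator and the unitors are part of the data. *)
Record sym_monoidal_category := SymMonoidalCategory {
  base_cat :> category;
  munit : base_cat;
  tensor : base_cat -> base_cat -> base_cat;
  tensorm : forall X X' Y Y' : base_cat,
    (X ~> X') -> (Y ~> Y') -> (tensor X Y ~> tensor X' Y');
  assoc : forall X Y Z, tensor (tensor X Y) Z ~> tensor X (tensor Y Z);
  assoc_inv : forall X Y Z, tensor X (tensor Y Z) ~> tensor (tensor X Y) Z;
  lunit : forall X, tensor munit X ~> X;
  lunit_inv : forall X, X ~> tensor munit X;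
  runit : forall X, tensor X munit ~> X;
  runit_inv : forall X, X ~> tensor X munit;
  braid : forall X Y, tensor X Y ~> tensor Y X;
  tensorm_id : forall X Y, tensorm (idm X) (idm Y) = idm (tensor X Y);
  tensorm_comp : forall (X X' X'' Y Y' Y'' : base_cat)
      (f' : X' ~> X'') (f : X ~> X') (g' : Y' ~> Y'') (g : Y ~> Y'),
    tensorm (f' ∘ f) (g' ∘ g) = tensorm f' g' ∘ tensorm f g;
  assocK : forall X Y Z, assoc_inv X Y Z ∘ assoc X Y Z = idm _;
  assocVK : forall X Y Z, assoc X Y Z ∘ assoc_inv X Y Z = idm _;
  lunitK : forall X, lunit_inv X ∘ lunit X = idm _;
  lunitVK : forall X, lunit X ∘ lunit_inv X = idm _;
  runitK : forall X, runit_inv X ∘ runit X = idm _;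
  runitVK : forall X, runit X ∘ runit_inv X = idm _;
  braidK : forall X Y, braid Y X ∘ braid X Y = idm _;
  assoc_nat : forall (X X' Y Y' Z Z' : base_cat)
      (f : X ~> X') (g : Y ~> Y') (h : Z ~> Z'),
    assoc X' Y' Z' ∘ tensorm (tensorm f g) h
    = tensorm f (tensorm g h) ∘ assoc X Y Z;
  lunit_nat : forall (X X' : base_cat) (f : X ~> X'),
    lunit X' ∘ tensorm (idm munit) f = f ∘ lunit X;
  runit_nat : forall (X X' : base_cat) (f : X ~> X'),
    runit X' ∘ tensorm f (idm munit) = f ∘ runit X;
  braid_nat : forall (X X' Y Y' : base_cat) (f : X ~> X') (g : Y ~> Y'),
    braid X' Y' ∘ tensorm f g = tensorm g f ∘ braid X Y;
  pentagon : forall X Y Z W,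
    assoc X Y (tensor Z W) ∘ assoc (tensor X Y) Z W
    = tensorm (idm X) (assoc Y Z W) ∘ assoc X (tensor Y Z) W
      ∘ tensorm (assoc X Y Z) (idm W);
  triangle : forall X Y,
    tensorm (idm X) (lunit Y) ∘ assoc X munit Y = tensorm (runit X) (idm Y);
  hexagon : forall X Y Z,
    assoc Y Z X ∘ braid X (tensor Y Z) ∘ assoc X Y Z
    = tensorm (idm Y) (braid X Z) ∘ assoc Y X Z ∘ tensorm (braid X Y) (idm Z)
}.
Arguments munit {s}.
Arguments tensor {s} X Y.
Arguments tensorm {s X X' Y Y'} f g.
Arguments assoc {s} X Y Z.
Arguments assoc_inv {s} X Y Z.
Arguments lunit {s} X.
Arguments lunit_inv {s} X.
Arguments runit {s} X.
Arguments runit_inv {s} X.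
Arguments braid {s} X Y.

Notation "X ⊗ Y" := (tensor X Y) : cat_scope.
Notation "f ⊗₁ g" := (tensorm f g) : cat_scope.

Definition middle_swap (C : sym_monoidal_category) (X X' Y Y' : C) :
    (X ⊗ X') ⊗ (Y ⊗ Y') ~> (X ⊗ Y) ⊗ (X' ⊗ Y') :=
  assoc_inv X Y (X' ⊗ Y')
  ∘ (idm X ⊗₁ (assoc Y X' Y' ∘ (braid X' Y ⊗₁ idm Y') ∘ assoc_inv X' Y Y'))
  ∘ assoc X X' (Y ⊗ Y').

(* The equation del_(X ⊗ Y) = del_X ⊗ del_Y (up to coherence) and the
   equations for the unit object hold because the unit is terminal. *)
Record markov_category := MarkovCategory {
  base_smc :> sym_monoidal_category;
  copy : forall X : base_smc, X ~> X ⊗ X;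
  del : forall X : base_smc, X ~> munit;
  del_unique : forall (X : base_smc) (f : X ~> munit), f = del X;
  copy_assoc : forall X,
    assoc X X X ∘ (copy X ⊗₁ idm X) ∘ copy X = (idm X ⊗₁ copy X) ∘ copy X;
  copy_unitl : forall X, lunit X ∘ (del X ⊗₁ idm X) ∘ copy X = idm X;
  copy_unitr : forall X, runit X ∘ (idm X ⊗₁ del X) ∘ copy X = idm X;
  copy_comm : forall X, braid X X ∘ copy X = copy X;
  copy_tensor : forall X Y,
    copy (X ⊗ Y) = middle_swap X X Y Y ∘ (copy X ⊗₁ copy Y)
}.
Arguments copy {m} X.
Arguments del {m} X.

Definition state (C : markov_category) (X : C) := munit ~> X.

Definition deterministic (C : markov_category) (X Y : C) (f : X ~> Y) : Prop :=
  copy Y ∘ f = (f ⊗₁ f) ∘ copy X.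

Definition as_equal (C : markov_category) (Y Z : C) (q : state Y)
    (f g : Y ~> Z) : Prop :=
  (idm Y ⊗₁ f) ∘ copy Y ∘ q = (idm Y ⊗₁ g) ∘ copy Y ∘ q.

Definition as_deterministic (C : markov_category) (Y Z : C) (q : state Y)
    (f : Y ~> Z) : Prop :=
  as_equal q (copy Z ∘ f) ((f ⊗₁ f) ∘ copy Y).

Definition is_disintegration (C : markov_category) (X Y : C) (p : state X)
    (f : X ~> Y) (fp : Y ~> X) : Prop :=
  (idm X ⊗₁ f) ∘ copy X ∘ p = (fp ⊗₁ idm Y) ∘ copy Y ∘ f ∘ p.

Definition has_disintegrations (C : markov_category) (X : C) : Prop :=
  forall (p : state X) (Y : C) (f : X ~> Y), deterministic f ->
    exists fp : Y ~> X, is_disintegration p f fp.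

(* The monoid is carried by an arbitrary type; it is given by its
   multiplication, an associative law [mul] with unit [e]. *)
Record dynamical_system (M : Type) (e : M) (mul : Monoid.law e)
    (C : category) := DynamicalSystem {
  ds_ob :> C;
  act : M -> (ds_ob ~> ds_ob);
  act_one : act e = idm ds_ob;
  act_mul : forall m n, act (mul m n) = act m ∘ act n
}.
Arguments act {M e mul C} d m.

Definition ds_deterministic (C : markov_category) (M : Type) (e : M)
    (mul : Monoid.law e) (X : dynamical_system mul C) : Prop :=
  forall m, deterministic (act X m).

Definition invariant_state (C : markov_category) (M : Type) (e : M)
    (mul : Monoid.law e) (X : dynamical_system mul C) (p : state X) : Prop :=
  forall m, act X m ∘ p = p.

Definition invariant_morphism (C : category) (M : Type) (e : M)
    (mul : Monoid.law e) (X : dynamical_system mul C) (R : C) (c : X ~> R) :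
    Prop :=
  forall m, c ∘ act X m = c.

Record is_markov_colimit (C : markov_category) (M : Type) (e : M)
    (mul : Monoid.law e) (X : dynamical_system mul C) (Xinv : C)
    (r : X ~> Xinv) : Prop := IsMarkovColimit {
  colim_det : deterministic r;
  colim_inv : invariant_morphism r;
  colim_univ : forall (S : C) (s : X ~> S), invariant_morphism s ->
    exists! t : Xinv ~> S, s = t ∘ r;
  colim_univ_det : forall (S : C) (s : X ~> S) (t : Xinv ~> S),
    invariant_morphism s -> s = t ∘ r -> (deterministic t <-> deterministic s)
}.

Record as_ergodic (C : markov_category) (M : Type) (e : M)
    (mul : Monoid.law e) (X : dynamical_system mul C) (Y : C) (q : state Y)
    (k : Y ~> X) : Prop := AsErgodic {
  ergodic_inv : forall m, as_equal q (act X m ∘ k) k;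
  ergodic_det : forall (R : C) (c : X ~> R),
    invariant_morphism c -> deterministic c ->
    as_deterministic q (c ∘ k)
}.

(* Main.v *)
Require Import Defs.
From mathcomp Require Import all_boot.

(** Take [Y] to be the Markov quotient [Xinv], [q] the image [r ∘ p] of the
    state, and [k] a disintegration of [p] via the quotient map [r].  The
    defining equation of [k] says that the joint state of [k] and the identity
    under [q] is the joint state of the identity and [r] under [p]; every claim
    about [k] is thereby turned into one about [p] (as_equal_disintegration).

    - Discarding the second output of that equation gives [p = k ∘ q].
    - Each [m] is deterministic and fixes [p], so it can be applied to both
      outputs of [copy ∘ p] at no cost, and [r] absorbs the [m] on its side.
      What is left is that [k] is almost surely invariant.
    - An invariant deterministic [c] factors as [t ∘ r] with [t] deterministic.
      Evaluating [t] on the quotient is the same as evaluating [c] on [X], so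
      [c ∘ k] is almost surely equal to [t], and a morphism almost surely equal
      to a deterministic one is almost surely deterministic
      (as_deterministic_of_as_equal). *)

Local Open Scope cat_scope.

Section AlmostSureEquality.

Variable C : markov_category.

Lemma tensorm_idl_comp (A X Y Z : C) (g : Y ~> Z) (f : X ~> Y) :
  idm A ⊗₁ (g ∘ f) = (idm A ⊗₁ g) ∘ (idm A ⊗₁ f).
Proof. by rewrite -tensorm_comp comp_idl. Qed.

Lemma tensorm_idr_comp (A X Y Z : C) (g : Y ~> Z) (f : X ~> Y) :
  (g ∘ f) ⊗₁ idm A = (g ⊗₁ idm A) ∘ (f ⊗₁ idm A).
Proof. by rewrite -tensorm_comp comp_idl. Qed.

Lemma braid_copy_state (X Y Z : C) (q : state X) (f : X ~> Y) (g : X ~> Z) :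
  braid Y Z ∘ ((f ⊗₁ g) ∘ (copy X ∘ q)) = (g ⊗₁ f) ∘ (copy X ∘ q).
Proof.
rewrite comp_assoc braid_nat -comp_assoc; congr (_ ∘ _).
by rewrite comp_assoc copy_comm.
Qed.

(** Since [copy] is commutative, almost sure equality may be tested with the
    input kept on the other side, which is the side on which disintegrations
    keep it. *)
Lemma as_equal_flip (Y Z : C) (q : state Y) (f g : Y ~> Z) :
  (f ⊗₁ idm Y) ∘ (copy Y ∘ q) = (g ⊗₁ idm Y) ∘ (copy Y ∘ q) ->
  as_equal q f g.
Proof.
move=> fg; rewrite /as_equal -!comp_assoc.
by rewrite -(braid_copy_state Y Z Y q f) fg braid_copy_state.
Qed.

Lemma as_equal_comp (Y Z W : C) (q : state Y) (h : Z ~> W) (f g : Y ~> Z) :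
  as_equal q f g -> as_equal q (h ∘ f) (h ∘ g).
Proof.
rewrite /as_equal -!comp_assoc => fg.
by rewrite !tensorm_idl_comp -!comp_assoc fg.
Qed.

(** Coassociativity moves the retained copy of the input next to [g], so that
    [f] is applied afterwards, to data that [g] and [g'] share. *)
Lemma as_equal_pair_r (Y Z W : C) (q : state Y) (f : Y ~> Z) (g g' : Y ~> W) :
  as_equal q g g' ->
  as_equal q ((f ⊗₁ g) ∘ copy Y) ((f ⊗₁ g') ∘ copy Y).
Proof.
rewrite /as_equal -!comp_assoc => gg'.
have factor (h : Y ~> W) :
    (idm Y ⊗₁ ((f ⊗₁ h) ∘ copy Y)) ∘ (copy Y ∘ q)
    = assoc Y Z W ∘ ((((idm Y ⊗₁ f) ∘ copy Y) ⊗₁ idm W)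
        ∘ ((idm Y ⊗₁ h) ∘ (copy Y ∘ q))).
  rewrite tensorm_idl_comp.
  rewrite -(comp_assoc (idm Y ⊗₁ (f ⊗₁ h))) (comp_assoc _ (copy Y) q).
  rewrite -copy_assoc !comp_assoc -assoc_nat.
  rewrite -!comp_assoc; congr (_ ∘ _); rewrite !comp_assoc.
  by rewrite -!tensorm_comp !comp_idl !comp_idr.
by rewrite !factor gg'.
Qed.

Lemma as_equal_pair_l (Y Z W : C) (q : state Y) (f f' : Y ~> Z) (g : Y ~> W) :
  as_equal q f f' ->
  as_equal q ((f ⊗₁ g) ∘ copy Y) ((f' ⊗₁ g) ∘ copy Y).
Proof.
have swap (h : Y ~> Z) : (h ⊗₁ g) ∘ copy Y = braid W Z ∘ ((g ⊗₁ h) ∘ copy Y).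
  by rewrite comp_assoc braid_nat -comp_assoc copy_comm.
by move=> ff'; rewrite !swap; apply/as_equal_comp/as_equal_pair_r.
Qed.

(** Both sides of the determinism equation are stable under almost sure
    equality: the left one as a postcomposition, the right one by replacing the
    two factors of the pairing one at a time. *)
Lemma as_deterministic_of_as_equal (Y Z : C) (q : state Y) (f g : Y ~> Z) :
  as_equal q f g -> deterministic g -> as_deterministic q f.
Proof.
move=> fg g_det; rewrite /as_deterministic.
have := as_equal_comp Y Z _ q (copy Z) f g fg.
have := as_equal_pair_l Y Z Z q f g f fg.
have := as_equal_pair_r Y Z Z q g f g fg.
by rewrite /as_equal g_det => -> -> ->.
Qed.

(** Discarding the second output of the joint state leaves the state itself. *)
Lemma disintegration_comp (X Y : C) (p : state X) (f : X ~> Y) (k : Y ~> X) :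
  is_disintegration p f k -> p = k ∘ (f ∘ p).
Proof.
have marginal (A B D : C) (s : state A) (g : A ~> B) (h : A ~> D) :
    runit B ∘ ((idm B ⊗₁ del D) ∘ ((g ⊗₁ h) ∘ (copy A ∘ s))) = g ∘ s.
  rewrite (comp_assoc _ (g ⊗₁ h)) -tensorm_comp comp_idl.
  rewrite (del_unique (del D ∘ h)) -{1}(comp_idr g) -(comp_idl (del A)).
  rewrite tensorm_comp !comp_assoc runit_nat.
  rewrite -!comp_assoc; congr (_ ∘ _); rewrite !comp_assoc.
  by rewrite copy_unitr comp_idl.
rewrite /is_disintegration -!comp_assoc => joint.
by rewrite -(marginal _ _ _ (f ∘ p) k (idm Y)) -joint marginal comp_idl.
Qed.

(** Almost sure statements about morphisms out of [Y] that start with [k] are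
    transported to [X], where [k] disappears and the retained input is
    recovered through [f]. *)
Lemma as_equal_disintegration (X Y Z : C) (p : state X) (f : X ~> Y)
    (k : Y ~> X) (c : X ~> Z) (t : Y ~> Z) :
  is_disintegration p f k ->
  (c ⊗₁ f) ∘ (copy X ∘ p) = (t ⊗₁ idm Y) ∘ (copy Y ∘ (f ∘ p)) ->
  as_equal (f ∘ p) (c ∘ k) t.
Proof.
rewrite /is_disintegration -!comp_assoc => joint ct; apply: as_equal_flip.
rewrite tensorm_idr_comp -comp_assoc -joint -ct.
by rewrite comp_assoc -tensorm_comp comp_idl comp_idr.
Qed.

End AlmostSureEquality.

Theorem theorem3p15 (C : markov_category) (M : Type) (e : M)
    (mul : Monoid.law e) (X : dynamical_system mul C)
    (X_det : ds_deterministic X)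
    (X_disint : has_disintegrations (X : C))
    (X_colim : exists (Xinv : C) (r : X ~> Xinv), is_markov_colimit r)
    (p : state (X : C)) (p_inv : invariant_state p) :
  exists (Y : C) (q : state Y) (k : Y ~> X),
    p = k ∘ q /\ as_ergodic q k.
Proof.
have [Xinv [r [r_det r_inv r_univ r_univ_det]]] := X_colim.
have [k k_dis] := X_disint p Xinv r r_det.
exists Xinv, (r ∘ p), k; split; first exact: disintegration_comp _ _ _ _ _ _ k_dis.
split=> [m | R c c_inv c_det].
- apply: (as_equal_disintegration _ _ _ _ _ _ _ _ _ k_dis).
  have <- : (idm X ⊗₁ r) ∘ (copy X ∘ p)
            = (k ⊗₁ idm Xinv) ∘ (copy Xinv ∘ (r ∘ p)).
    by move: k_dis; rewrite /is_disintegration -!comp_assoc.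
  (* Invariance of [r] frees a factor [m] on its side, and determinism merges
     it with the other one. *)
  rewrite -{1}(r_inv m) -{1}(comp_idl (act X m)) tensorm_comp -comp_assoc.
  by rewrite (comp_assoc _ (copy X)) -(X_det m) -comp_assoc p_inv.
- have [t [c_t _]] := r_univ R c c_inv.
  have t_det : deterministic t by apply/(r_univ_det R c t c_inv c_t).
  apply: (as_deterministic_of_as_equal _ _ _ _ _ t) t_det.
  apply: (as_equal_disintegration _ _ _ _ _ _ _ _ _ k_dis).
  rewrite c_t -{2}(comp_idl r) tensorm_comp -comp_assoc.
  by rewrite (comp_assoc _ (copy X)) -r_det -comp_assoc.
Qed.
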